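(* Let $X^{\mathrm{in}}\subseteq\mathbb{R}^d$ be nonempty, let $T:\mathbb{R}^d\to\mathbb{R}^d$ be a nonzero map, and let $\varphi:\mathbb{R}^d\to\mathbb{R}$ satisfy $\varphi(0)=0$. For $k\in\mathbb{N}$ let $\nu_k:=\sup\{\varphi(T^k(x)) : x\in X^{\mathrm{in}}\}$, and assume that $\nu_k$ is finite for every $k\in\mathbb{N}$; write $\nu=(\nu_k)_{k\in\mathbb{N}}$. Assume that $X^{\mathrm{in}}$ is bounded and not reduced to $\{0\}$. Suppose that $\varphi$ is continuous and that there exists a Lyapunov function $V$ for $T$ on some $\mathcal{D}\in\operatorname{Sta}(T)$ such that $X^{\mathrm{in}}\subseteq\mathcal{D}$. Put $\overline{V}:=\sup_{x\in X^{\mathrm{in}}}V(x)$. Suppose that there exists $\alpha_V\in\mathcal{K}$ satisfying $\alpha_V(\|x\|)\leq V(x)$ for all $x\in\mathcal{D}$ and $\alpha_V(s)>\overline{V}$ for some $s\in(0,+\infty)$. Let $\alpha\in\mathcal{K}_\infty$ satisfy $\varphi(x)\leq\alpha(\|x\|)$ for all $x\in\mathbb{R}^d$. Define $$h: s\mapsto \alpha\left(\alpha_V^{-1}\left(s\,\overline{V}\right)\right)$$ for all $s\in\mathbb{R}_+$ such that $s\overline{V}$ lies in the range of $\alpha_V$ (this set contains $[0,1]$). Then $(h,N_T^{\mathcal{D}}(V))\in\Gamma(\nu)$. If, moreover, there exist $k\in\mathbb{N}$ and $x\in X^{\mathrm{in}}$ with $\varphi(T^k(x))>0$, then $h$ is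 useful for $\nu$.
   Context: $\mathbb{N}$ includes $0$; $\mathbb{R}_+=[0,+\infty)$; $\|\cdot\|$ is the Euclidean norm on $\mathbb{R}^d$; $T^k$ is the $k$-fold composition of $T$, with $T^0=\mathrm{Id}$. A function $\alpha:[0,a)\to\mathbb{R}_+$ (for some $a>0$, possibly $a=+\infty$) belongs to $\mathcal{K}$ if it is strictly increasing and continuous on $[0,a)$ and $\alpha(0)=0$; if moreover $a=+\infty$ and $\lim_{x\to+\infty}\alpha(x)=+\infty$, then $\alpha\in\mathcal{K}_\infty$. An inequality involving $\alpha_V(\|x\|)$ for $x\in\mathcal{D}$ or $\alpha_V(s)$ presupposes that the argument lies in the domain of $\alpha_V$. Stable sets. For $F:\mathbb{R}^d\to\mathbb{R}^d$, $\operatorname{Sta}(F):=\{\mathcal{D}\subseteq\mathbb{R}^d : \mathcal{D}\text{ closed},\ 0\in\mathcal{D},\ \mathcal{D}\neq\{0\},\ F(\mathcal{D})\subseteq\mathcal{D}\}$. Lyapunov functions. A function $V:\mathbb{R}^d\to\mathbb{R}$ is a (local) Lyapunov function for $F$ on $X\in\operatorname{Sta}(F)$ if (i) there exist $\alpha_1,\alpha_2\in\mathcal{K}$ (whose domains contain $\{\|x\| : x\in X\}$) such that $\alpha_1(\|x\|)\leq V(x)\leq\alpha_2(\|x\|)$ for all $x\in X$; and (ii) there exists $\lambda\in(0,1)$ such that $V(F(x))\leq\lambda V(x)$ for all $x\in X$. Ratio operator. For $F:\mathbb{R}^d\to\mathbb{R}^d$ with $F(0)=0$, $X\in\operatorname{Sta}(F)$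 and $W$ nonnegative on $X$ vanishing on $X$ exactly at $0$, $N_F^X(W):=\sup_{x\in X,\,x\neq0}\dfrac{W(F(x))}{W(x)}\in[0,+\infty]$. (A Lyapunov function $V$ for $F$ on $X$ is nonnegative on $X$ and vanishes there exactly at $0$, and its existence forces $F(0)=0$.) Upper-bounding pairs. $\Omega([0,1])$ is the set of functions $h:\mathbb{R}\to\mathbb{R}$ that are strictly increasing and continuous on $[0,1]$; such a function may be given only on a set containing $[0,1]$, its extension to $\mathbb{R}$ being arbitrary. For a real sequence $u=(u_k)_{k\in\mathbb{N}}$, $\Gamma(u):=\{(h,\beta)\in\Omega([0,1])\times(0,1) : u_k\leq h(\beta^k)\ \forall k\in\mathbb{N}\}$. For $u$ bounded above with $\{k : u_k>\limsup_{n\to+\infty}u_n\}\neq\emptyset$, a function $h\in\Omega([0,1])$ for which there is $\beta\in(0,1)$ with $(h,\beta)\in\Gamma(u)$ is called useful for $u$ if $\{k\in\mathbb{N} : u_k>h(0)\}\neq\emptyset$.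
   Formalization: The claim (h, N_T^D(V)) ∈ Γ(ν) is proved assuming also that T is not identically zero on D; if T vanishes on D but not elsewhere, N_T^D(V) = 0 is not in (0,1) and the claim fails. Usefulness of h needs no such assumption. *)

(* Defs.v *)
From mathcomp Require Import all_boot all_order all_algebra.
From mathcomp Require Import all_classical all_reals all_analysis.
Import Order.TTheory GRing.Theory Num.Theory.
Import numFieldNormedType.Exports.

Set Implicit Arguments.
Unset Strict Implicit.
Unset Printing Implicit Defensive.

Local Open Scope classical_set_scope.
Local Open Scope ring_scope.

(* The library norm on 'rV[R]_d is the max norm. It induces the same topology
   and the same bounded sets as the Euclidean one, so closed, continuous and
   bounded_set are taken from the library. *)
Definition enorm (R : realType) (d : nat) (x : 'rV[R]_d) : R :=
  Num.sqrt (\sum_(i < d) x ord0 i ^+ 2).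

(* The interval [0, a[, where a may be +oo. *)
Definition Kdom (R : realType) (a : \bar R) : set R :=
  [set s | 0 <= s /\ (s%:E < a)%E].

(* A comparison function with domain [0, a[ is a function on R whose values
   outside Kdom a are irrelevant. *)
Definition class_K (R : realType) (a : \bar R) (f : R -> R) : Prop :=
  [/\ (0 < a)%E,
      forall s t, Kdom a s -> Kdom a t -> s < t -> f s < f t,
      {within Kdom a, continuous f} &
      f 0 = 0].

Definition class_Kinfty (R : realType) (f : R -> R) : Prop :=
  class_K +oo%E f /\ f x @[x --> +oo] --> +oo.

(* Meaningful only on the range f @` Kdom a. *)
Definition Kinv (R : realType) (a : \bar R) (f : R -> R) : R -> R :=
  pinv (Kdom a) f.

Definition Sta (R : realType) (d : nat) (F : 'rV[R]_d -> 'rV[R]_d) :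
    set (set 'rV[R]_d) :=
  [set D : set ('rV[R]_d) | [/\ closed D, D 0, D <> [set 0] & F @` D `<=` D]].

Definition Lyapunov (R : realType) (d : nat) (F : 'rV[R]_d -> 'rV[R]_d)
    (X : set 'rV[R]_d) (V : 'rV[R]_d -> R) : Prop :=
  (exists (a1 a2 : \bar R) (f1 f2 : R -> R),
     [/\ class_K a1 f1, class_K a2 f2 &
      forall x, X x ->
        [/\ Kdom a1 (enorm x), Kdom a2 (enorm x) &
            f1 (enorm x) <= V x <= f2 (enorm x)]]) /\
  (exists2 lambda : R, 0 < lambda < 1 &
     forall x, X x -> V (F x) <= lambda * V x).

Definition ratio_op (R : realType) (d : nat) (F : 'rV[R]_d -> 'rV[R]_d)
    (X : set 'rV[R]_d) (W : 'rV[R]_d -> R) : \bar R :=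
  ereal_sup [set (W (F x) / W x)%:E | x in [set x | X x /\ x != 0]].

Definition Omega01 (R : realType) : set (R -> R) :=
  [set h : R -> R | {in `[0, 1] &, {homo h : s t / s < t}} /\
           {within `[0, 1], continuous h}].

Definition Gamma (R : realType) (u : nat -> R) : set ((R -> R) * R) :=
  [set p : (R -> R) * R | [/\ Omega01 p.1, 0 < p.2 < 1 & forall k, u k <= p.1 (p.2 ^+ k)]].

(* The first two conjuncts are the conditions on u under which usefulness is
   defined. *)
Definition useful (R : realType) (u : nat -> R) (h : R -> R) : Prop :=
  [/\ has_ubound (range u),
      exists k, (limn_esup (fun n => (u n)%:E) < (u k)%:E)%E,
      exists beta, Gamma u (h, beta) &
      exists k, h 0 < u k].

Definition nu_ext (R : realType) (d : nat) (Xin : set 'rV[R]_d)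
    (T : 'rV[R]_d -> 'rV[R]_d) (phi : 'rV[R]_d -> R) (k : nat) : \bar R :=
  ereal_sup [set (phi (iter k T x))%:E | x in Xin].

Definition sup_on (R : realType) (d : nat) (Xin : set 'rV[R]_d)
    (V : 'rV[R]_d -> R) : \bar R :=
  ereal_sup [set (V x)%:E | x in Xin].

(* Main.v *)
Require Import Defs.
From mathcomp Require Import all_boot all_order all_algebra.
From mathcomp Require Import all_classical all_reals all_analysis.
Import Order.TTheory GRing.Theory Num.Theory.
Import numFieldNormedType.Exports.

Local Open Scope classical_set_scope.
Local Open Scope ring_scope.

(** Write [Vbar] for the supremum of [V] over the initial set and [g] for the
    inverse of [alphaV].  Along a trajectory issued from the initial set the
    contraction [V (T x) <= beta * V x] gives
    [alphaV (enorm (T^k x)) <= V (T^k x) <= beta^k * Vbar], hence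
    [enorm (T^k x) <= g (beta^k * Vbar)], hence
    [phi (T^k x) <= alpha (g (beta^k * Vbar)) = h (beta^k)]; taking the supremum
    over [x] bounds [nu k].  This works for every rate [beta] in ]0, 1[ for
    which the contraction holds ([Gamma_of_decay]).  The ratio operator is the
    best such rate: it is at most the Lyapunov rate [lambda], and it is positive
    as soon as [T] does not vanish identically on [D] ([ratio_op_rate]).

    That [h] is increasing and continuous on [0, 1] is read off the
    reparametrization [s = alphaV r / Vbar], under which [h] becomes [alpha]:
    it is increasing because both [alphaV] and [alpha] are, and it takes every
    value between [h 0] and [h 1] because [alpha] does; an increasing function
    with no jump is continuous ([Omega01_reparam]).

    For usefulness, the bound [u k <= h (beta^k)] and the continuity of [h] at
    [0] force [limsup u <= h 0], so a term above [h 0] is also above the limsup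
    ([useful_of_Gamma]).  Here [h 0 = alpha 0 = 0], and a positive value of
    [phi] along a trajectory makes some [nu k] positive.  The rate used in this
    second part is [lambda], which is positive in all cases. *)

(** * Euclidean norm and comparison functions *)

Lemma enorm0 (R : realType) (d : nat) : enorm (0 : 'rV[R]_d) = 0.
Proof.
rewrite /enorm big1 ?sqrtr0// => i _.
by rewrite mxE expr0n.
Qed.

Lemma enorm_gt0 (R : realType) (d : nat) (x : 'rV[R]_d) :
  x != 0 -> 0 < enorm x.
Proof.
move=> x0; rewrite /enorm sqrtr_gt0 lt_neqAle sumr_ge0 ?andbT; last first.
  by move=> i _; exact: sqr_ge0.
apply: contra x0; rewrite eq_sym psumr_eq0; last by move=> i _; exact: sqr_ge0.
move=> /allP x0; apply/eqP/rowP => i.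
by have := x0 i (mem_index_enum i); rewrite mxE sqrf_eq0 => /eqP.
Qed.

Section ClassK.
Variables (R : realType) (a : \bar R) (f : R -> R).
Hypothesis fK : class_K a f.

Lemma Kdom_le (s t : R) : 0 <= s -> s <= t -> Kdom a t -> Kdom a s.
Proof.
move=> s0 st [t0 ta]; split => //.
by apply: le_lt_trans ta; rewrite lee_fin.
Qed.

Lemma Kdom0 : Kdom a 0.
Proof. by case: fK => a0 _ _ _; split. Qed.

Lemma class_K_le : {in Kdom a &, {mono f : s t / s <= t}}.
Proof.
have [_ f_lt _ _] := fK; apply: le_mono_in => s t.
by rewrite !inE => as_ at_; exact: f_lt.
Qed.

Lemma class_K_gt0 (t : R) : Kdom a t -> 0 < t -> 0 < f t.
Proof.
have [_ f_lt _ f0] := fK.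
by move=> at_ t0; rewrite -f0; apply: f_lt => //; exact: Kdom0.
Qed.

Lemma class_K_surj (t y : R) : Kdom a t -> 0 <= y <= f t ->
  exists2 s, 0 <= s <= t & f s = y.
Proof.
have [_ _ f_cont f0] := fK.
move=> at_ yft; have t0 := at_.1.
have ct : {within `[0, t], continuous f}.
  apply: continuous_subspaceW f_cont => s /=; rewrite in_itv/= => /andP[s0 st].
  exact: Kdom_le at_.
have f0t : f 0 <= f t by rewrite f0; case/andP: yft => /le_trans; apply.
have [|s st <-] := IVT t0 ct (v := y).
  by rewrite min_l// max_r// f0.
by exists s => //; rewrite in_itv in st.
Qed.

Lemma KinvK (t : R) : Kdom a t -> Kinv a f (f t) = t.
Proof.
move=> at_; apply: pinvKV; rewrite ?inE//.
exact: inc_inj_in class_K_le.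
Qed.

End ClassK.

(** * Reparametrized comparison functions *)

(** The function [s |-> alpha (f^-1 (s * c))] is described by the equation
    [h (f r / c) = alpha r], which avoids every mention of an inverse. *)
Lemma Omega01_reparam (R : realType) (a b : \bar R) (f alpha h : R -> R)
    (c t : R) :
  class_K a f -> class_K b alpha -> (forall r, Kdom a r -> Kdom b r) ->
  0 < c -> Kdom a t -> c <= f t ->
  (forall r, Kdom a r -> h (f r / c) = alpha r) -> Omega01 h.
Proof.
move=> fK alphaK ab c0 at_ cft hE.
have f0 : f 0 = 0 by case: fK.
have [r1 /andP[r10 r1t] fr1] : exists2 r, 0 <= r <= t & f r = c.
  by apply: (class_K_surj _ _ _ fK) => //; rewrite ltW.
have ar1 : Kdom a r1 by exact: Kdom_le at_.
have param s : s \in `[0, 1] -> exists2 r, Kdom a r & s = f r / c.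
  rewrite in_itv/= => /andP[s0 s1].
  have [|r /andP[r0 rr1] frs] := class_K_surj _ _ _ fK r1 (s * c) ar1.
    by rewrite fr1 mulr_ge0 ?ler_piMl// ltW.
  exists r; first exact: Kdom_le ar1.
  by rewrite frs mulfK// gt_eqF.
have h_le : {in `[0, 1] &, {mono h : s s' / s <= s'}}.
  move=> _ _ /param[r ar ->] /param[r' ar' ->].
  rewrite !hE// ler_pM2r ?invr_gt0//.
  by rewrite (class_K_le _ _ _ fK) ?(class_K_le _ _ _ alphaK) ?inE//; exact: ab.
split; first by move=> s s' s01 s'01; rewrite (leW_mono_in h_le).
(* A preimage of y by alpha, read through s = f r / c, is a preimage by h. *)
apply: segment_inc_surj_continuous => // y /=.
have h0 : h 0 = 0.
  have := hE 0 (Kdom0 _ _ _ fK); rewrite f0 mul0r => ->.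
  by case: alphaK.
have h1 : h 1 = alpha r1.
  by have := hE r1 ar1; rewrite fr1 divff// gt_eqF.
rewrite in_itv/= h0 h1 => yr1.
have [r /andP[r0 rr1] <-] := class_K_surj _ _ _ alphaK r1 y (ab _ ar1) yr1.
have ar : Kdom a r by exact: Kdom_le ar1.
exists (f r / c); last exact: hE.
rewrite /= in_itv/= divr_ge0 ?(ltW c0)//=; last first.
  by rewrite -f0 (class_K_le _ _ _ fK) ?inE//; exact: Kdom0 fK.
by rewrite ler_pdivrMr// mul1r -fr1 (class_K_le _ _ _ fK) ?inE.
Qed.

(** * Upper-bounding pairs and usefulness *)

(** Letting [k] grow in [u k <= h (beta^k)]: [beta^k] tends to [0] from the
    right, where [h] is continuous. *)
Lemma limn_esup_le_Gamma (R : realType) (u : nat -> R) (h : R -> R)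
    (beta : R) :
  Gamma u (h, beta) -> (limn_esup (fun n => (u n)%:E) <= (h 0)%:E)%E.
Proof.
move=> [/= [_ h_cont] /andP[beta0 beta1] uh].
have [_ h_right _] := (continuous_within_itvP h (@ltr01 R)).1 h_cont.
have hbeta : h (beta ^+ n) @[n --> \oo] --> h 0.
  move/cvg_at_rightP: h_right; apply; split.
    by move=> n; exact: exprn_gt0.
  by apply: cvg_expr; rewrite ger0_norm// ltW.
apply/lee_addgt0Pr => e e0.
have : \forall n \near \oo, h (beta ^+ n) <= h 0 + e.
  by apply: cvgr_le hbeta _ _; rewrite ltrDl.
move=> near_le; apply: (@le_trans _ _ (ereal_sup
   ((fun n => (u n)%:E) @` [set n | h (beta ^+ n) <= h 0 + e]))).
  by apply: ereal_inf_lbound; exists [set n | h (beta ^+ n) <= h 0 + e].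
apply: ge_ereal_sup => _ [n /= hn <-].
by rewrite lee_fin (le_trans (uh n)).
Qed.

(** The two conditions under which usefulness makes sense come for free from an
    upper-bounding pair. *)
Lemma useful_of_Gamma (R : realType) (u : nat -> R) (h : R -> R) (beta : R) :
  Gamma u (h, beta) -> (exists k, h 0 < u k) -> useful u h.
Proof.
move=> uG [k hk]; split; [|exists k|by exists beta|by exists k].
- case: uG => /= -[h_lt _] /andP[beta0 beta1] uh.
  exists (h 1) => _ [n _ <-]; apply: (le_trans (uh n)).
  have bn1 : beta ^+ n <= 1 by rewrite exprn_ile1// ltW.
  rewrite le_eqVlt in bn1; case/orP: bn1 => [/eqP->//|bn1].
  apply/ltW/h_lt => //; rewrite in_itv/= ?ler01 ?lexx//.
  by rewrite exprn_ge0 ltW.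
- by apply: le_lt_trans (limn_esup_le_Gamma _ _ _ _ uG) _; rewrite lte_fin.
Qed.

(** * Lyapunov functions and the ratio operator *)

Section LyapunovTheory.
Variables (R : realType) (d : nat) (F : 'rV[R]_d -> 'rV[R]_d).
Variables (X : set 'rV[R]_d) (V : 'rV[R]_d -> R).
Hypothesis V_lyap : Lyapunov F X V.

Lemma Lyapunov0 : X 0 -> V 0 = 0.
Proof.
case: V_lyap => -[a1 [a2 [f1 [f2 [[_ _ _ f10] [_ _ _ f20] Vf]]]]] _ X0.
have [_ _] := Vf _ X0; rewrite enorm0 f10 f20 => V0.
by apply/le_anti; rewrite andbC.
Qed.

Lemma Lyapunov_gt0 (x : 'rV[R]_d) : X x -> x != 0 -> 0 < V x.
Proof.
case: V_lyap => -[a1 [a2 [f1 [f2 [f1K _ Vf]]]]] _ Xx x0.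
have [a1x _ /andP[f1V _]] := Vf _ Xx.
apply: lt_le_trans f1V; apply: (class_K_gt0 _ _ _ f1K) => //.
exact: enorm_gt0.
Qed.

Hypothesis X_sta : Sta F X.

Lemma Lyapunov_ge0 (x : 'rV[R]_d) : X x -> 0 <= V x.
Proof.
have [_ X0 _ _] := X_sta.
move=> Xx; have [->|x0] := eqVneq x 0; first by rewrite Lyapunov0.
exact/ltW/Lyapunov_gt0.
Qed.

(** [V (F 0) <= lambda * V 0 = 0] and [V] is positive off the origin. *)
Lemma Lyapunov_map0 : F 0 = 0.
Proof.
have [_ X0 _ FX] := X_sta; have [_ [l _ Vl]] := V_lyap.
apply/eqP; apply: contraT => F0.
have := Vl _ X0; rewrite (Lyapunov0 X0) mulr0 leNgt Lyapunov_gt0//.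
by apply: FX; exists 0.
Qed.

(** The supremum is at most the rate of the Lyapunov inequality, and any upper
    bound of the ratios is again a contraction rate; at the origin, where no
    ratio is taken, the contraction reads [0 <= 0] since [F 0 = 0].  A point
    that [F] does not send to [0] is itself nonzero and has a positive ratio. *)
Lemma ratio_op_rate :
  exists2 beta : R, ratio_op F X V = beta%:E &
    [/\ 0 <= beta < 1, forall x, X x -> V (F x) <= beta * V x &
        (exists2 x, X x & F x != 0) -> 0 < beta].
Proof.
have [_ X0 XN0 FX] := X_sta; have [_ [l /andP[l0 l1] Vl]] := V_lyap.
have XF x : X x -> X (F x) by move=> Xx; apply: FX; exists x.
have ub x : X x -> x != 0 -> ((V (F x) / V x)%:E <= ratio_op F X V)%E.
  by move=> Xx x0; apply: ereal_sup_ubound; exists x.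
have le_l : (ratio_op F X V <= l%:E)%E.
  apply: ge_ereal_sup => _ [x [Xx x0] <-].
  by rewrite lee_fin ler_pdivrMr ?Vl//; exact: Lyapunov_gt0.
have [y Xy y0] : exists2 y, X y & y != 0.
  apply: contrapT => noy; apply: XN0; apply/seteqP; split => [x Xx|_ ->//].
  by apply/eqP; apply: contraT => x0; case: noy; exists x.
have ge0 : (0 <= ratio_op F X V)%E.
  apply: le_trans (ub _ Xy y0).
  by rewrite lee_fin divr_ge0// Lyapunov_ge0//; exact: XF.
exists (fine (ratio_op F X V)).
  by rewrite fineK// ge0_fin_numE// (le_lt_trans le_l)// ltry.
case: (ratio_op F X V) ub le_l ge0 => [b|//|//].
rewrite !lee_fin /= => ub bl b0.
split; first by rewrite b0 (le_lt_trans bl).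
- move=> x Xx; have [->|x0] := eqVneq x 0.
    by rewrite Lyapunov_map0 Lyapunov0// mulr0.
  by rewrite -ler_pdivrMr ?Lyapunov_gt0// -lee_fin ub.
- move=> [x Xx Fx0]; have x0 : x != 0.
    by apply: contraNneq Fx0 => ->; rewrite Lyapunov_map0.
  have := ub _ Xx x0; rewrite lee_fin; apply: lt_le_trans.
  by rewrite divr_gt0// Lyapunov_gt0//; exact: XF.
Qed.

End LyapunovTheory.

(** * Bounds along trajectories *)

Lemma iter_decay (R : realType) (U : Type) (F : U -> U) (X : set U)
    (V : U -> R) (beta : R) :
  F @` X `<=` X -> 0 <= beta -> (forall x, X x -> V (F x) <= beta * V x) ->
  forall k x, X x -> X (iter k F x) /\ V (iter k F x) <= beta ^+ k * V x.
Proof.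
move=> FX beta0 VF k x Xx; elim: k => [|k [Xk Vk]] /=.
  by rewrite expr0 mul1r.
split; first by apply: FX; exists (iter k F x).
by rewrite (le_trans (VF _ Xk))// exprS -mulrA ler_wpM2l.
Qed.

Lemma sup_on_fin (R : realType) (d : nat) (A : set 'rV[R]_d)
    (V : 'rV[R]_d -> R) (M : R) :
  A !=set0 -> (sup_on A V < M%:E)%E -> sup_on A V \is a fin_num.
Proof.
move=> [x Ax] VM; rewrite fin_real// (lt_trans VM (ltry _)) andbT.
apply: lt_le_trans (ltNyr (V x)) _.
by apply: ereal_sup_ubound; exists x.
Qed.

(** The [k]-th iterates of the initial points lie in [D] at a level of [V] not
    exceeding [beta^k * c].  If [r] is the preimage of that level by [f], then
    their norms are at most [r], so [phi] is at most [alpha r = h (beta^k)]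
    there. *)
Lemma Gamma_of_decay (R : realType) (d : nat) (Xin D : set 'rV[R]_d)
    (T : 'rV[R]_d -> 'rV[R]_d) (phi V : 'rV[R]_d -> R) (nu : nat -> R)
    (a b : \bar R) (f alpha h : R -> R) (c t beta : R) :
  (forall k, nu_ext Xin T phi k = (nu k)%:E) ->
  Xin `<=` D -> T @` D `<=` D ->
  class_K a f -> class_K b alpha -> (forall r, Kdom a r -> Kdom b r) ->
  (forall x, D x -> Kdom a (enorm x) /\ f (enorm x) <= V x) ->
  (forall x, phi x <= alpha (enorm x)) ->
  0 < c -> (forall x, Xin x -> V x <= c) -> Kdom a t -> c <= f t ->
  (forall r, Kdom a r -> h (f r / c) = alpha r) ->
  0 < beta < 1 -> (forall x, D x -> V (T x) <= beta * V x) ->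
  Gamma nu (h, beta).
Proof.
move=> nuE XinD TD fK alphaK ab fV phi_le c0 Vc at_ cft hE beta01 VT.
have [beta0 beta1] := andP beta01.
split => //=; first exact: (Omega01_reparam _ a b f alpha h c t).
(* The level beta^k * c lies in the range of f because c <= f t. *)
move=> k; have bk0 : 0 <= beta ^+ k by rewrite exprn_ge0// ltW.
have [|r /andP[r0 rt] fr] := class_K_surj _ _ _ fK t (beta ^+ k * c) at_.
  rewrite mulr_ge0 ?(ltW c0)//=; apply: le_trans cft.
  by rewrite ler_piMl ?exprn_ile1 ?(ltW c0) ?(ltW beta0) ?(ltW beta1).
have ar : Kdom a r by exact: Kdom_le at_.
have -> : h (beta ^+ k) = alpha r by rewrite -hE// fr mulfK// gt_eqF.
rewrite -lee_fin -nuE; apply: ge_ereal_sup => _ [x Xx <-]; rewrite lee_fin.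
have [Dk Vk] := iter_decay _ _ _ _ _ _ TD (ltW beta0) VT k x (XinD _ Xx).
have [ak fk] := fV _ Dk.
apply: (le_trans (phi_le _)).
rewrite (class_K_le _ _ _ alphaK) ?inE; [|exact: ab|exact: ab].
rewrite -(class_K_le _ _ _ fK) ?inE// fr.
by rewrite (le_trans fk)// (le_trans Vk)// ler_wpM2l// Vc.
Qed.

Theorem theorem7 (R : realType) (d : nat) (Xin : set 'rV[R]_d)
    (T : 'rV[R]_d -> 'rV[R]_d) (phi : 'rV[R]_d -> R)
    (Xin_nonempty : Xin !=set0)
    (T_nonzero : exists x, T x != 0)
    (phi0 : phi 0 = 0)
    (nu : nat -> R)
    (nuE : forall k, nu_ext Xin T phi k = (nu k)%:E)
    (Xin_bounded : bounded_set Xin)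
    (Xin_not0 : Xin <> [set 0])
    (phi_cont : continuous phi)
    (D : set 'rV[R]_d) (V : 'rV[R]_d -> R)
    (D_sta : Sta T D)
    (V_lyap : Lyapunov T D V)
    (Xin_D : Xin `<=` D)
    (aV : \bar R) (alphaV : R -> R)
    (alphaV_K : class_K aV alphaV)
    (alphaV_le : forall x, D x ->
       Kdom aV (enorm x) /\ alphaV (enorm x) <= V x)
    (alphaV_gt : exists s : R,
       [/\ 0 < s, Kdom aV s & (sup_on Xin V < (alphaV s)%:E)%E])
    (alpha : R -> R)
    (alpha_Kinfty : class_Kinfty alpha)
    (phi_le : forall x, phi x <= alpha (enorm x))
    (h : R -> R)
    (hE : forall s : R, 0 <= s ->
       (alphaV @` Kdom aV) (s * fine (sup_on Xin V)) ->
       h s = alpha (Kinv aV alphaV (s * fine (sup_on Xin V)))) :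
  ((exists2 x, D x & T x != 0) ->
     exists2 beta : R, ratio_op T D V = beta%:E & Gamma nu (h, beta)) /\
  ((exists k x, Xin x /\ 0 < phi (iter k T x)) -> useful nu h).
Proof.
have [_ D0 _ TD] := D_sta; have [t [t0 at_ supt]] := alphaV_gt.
have supE := fineK (sup_on_fin _ _ _ _ _ Xin_nonempty supt).
set c := fine _ in hE supE.
have Vc x : Xin x -> V x <= c.
  by move=> Xx; rewrite -lee_fin supE; apply: ereal_sup_ubound; exists x.
have [x0 Xx0 x00] : exists2 x, Xin x & x != 0.
  apply: contrapT => nox; apply: Xin_not0.
  have all0 x : Xin x -> x = 0.
    by move=> Xx; apply/eqP; apply: contraT => x0; case: nox; exists x.
  have [y Xy] := Xin_nonempty.
  by apply/seteqP; split => [x /all0//|_ ->]; rewrite -(all0 _ Xy).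
have c0 : 0 < c.
  apply: lt_le_trans (Vc _ Xx0).
  by apply: (Lyapunov_gt0 _ _ _ _ _ V_lyap) => //; exact: Xin_D.
have h_param r : Kdom aV r -> h (alphaV r / c) = alpha r.
  move=> ar; have [_ _ _ aV0] := alphaV_K.
  have cK : alphaV r / c * c = alphaV r by rewrite divfK// gt_eqF.
  rewrite hE; first by rewrite cK (KinvK _ _ _ alphaV_K).
    rewrite divr_ge0// ?(ltW c0)// -aV0.
    by rewrite (class_K_le _ _ _ alphaV_K) ?inE ?ar.1//; exact: Kdom0 alphaV_K.
  by rewrite cK; exists r.
have nuG beta : 0 < beta < 1 -> (forall x, D x -> V (T x) <= beta * V x) ->
    Gamma nu (h, beta).
  apply: (Gamma_of_decay _ _ Xin D T phi V nu aV +oo%E alphaV alpha h c t)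
    => //.
  - exact: alpha_Kinfty.1.
  - by move=> r [r0 _]; split => //; exact: ltry.
  - by rewrite -lee_fin supE ltW.
split.
- move=> TD0; have [beta -> [/andP[_ beta1] VT beta0]] :=
    ratio_op_rate _ _ _ _ _ V_lyap D_sta.
  by exists beta => //; apply: nuG => //; rewrite beta0.
- move=> [k [x [Xx phix]]]; have [_ [l l01 Vl]] := V_lyap.
  apply: (useful_of_Gamma _ _ _ l); first exact: nuG.
  exists k.
  have -> : h 0 = 0.
    have [[_ _ _ alpha0] _] := alpha_Kinfty; have [_ _ _ aV0] := alphaV_K.
    have := h_param 0 (Kdom0 _ _ _ alphaV_K).
    by rewrite aV0 mul0r alpha0.
  apply: lt_le_trans phix _; rewrite -lee_fin -nuE.
  by apply: ereal_sup_ubound; exists x.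
Qed.
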